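(* Consider a delay-free acyclic network and a sink $t$. If $K$ is a monomial in the support of the determinant of the Edmonds matrix $M_t$, then $K$ is of the form $K=K_1\cdots K_h$ where, for $u=1,\dots,h$, $$K_u=a_{u,l^{(u)}_1}\,f_{l^{(u)}_1,l^{(u)}_2}\,f_{l^{(u)}_2,l^{(u)}_3}\cdots f_{l^{(u)}_{s_u-1},l^{(u)}_{s_u}}\,b_{t,v_u,l^{(u)}_{s_u}}$$ for some $s_u\ge 1$ and edges $l^{(u)}_1,\dots,l^{(u)}_{s_u}$. Here $\{v_1,\dots,v_h\}=\{1,\dots,h\}$, the edges $l^{(1)}_1,\dots,l^{(h)}_1$ are pairwise different, and the edges $l^{(1)}_{s_1},\dots,l^{(h)}_{s_h}$ are pairwise different. Further, $$f_{l^{(u_1)}_i,l^{(u_1)}_{i+1}}\neq f_{l^{(u_2)}_j,l^{(u_2)}_{j+1}}$$ unless $u_1=u_2$ and $i=j$. In other words, $K$ corresponds to a product of $h$ edge disjoint paths.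
   Context: Network model. $G=(V,E)$ is a finite directed acyclic graph, possibly with parallel edges; $S\subseteq V$ is the set of sources and $T\subseteq V$ the set of sinks, $t\in T$. The sources together generate $h$ symbols, indexed $1,\dots,h$, each symbol belonging to one source. Edges are identified with $1,\dots,|E|$; for an edge $j=(u,v)$, $\mathrm{tail}(j)=u$ and $\mathrm{head}(j)=v$. Matrices. $F=(f_{i,j})$ is the $|E|\times|E|$ matrix in which $f_{i,j}$ is a variable if $\mathrm{head}(i)=\mathrm{tail}(j)$ and $f_{i,j}=0$ otherwise. $A=(a_{i,j})$ is the $h\times|E|$ matrix in which $a_{i,j}$ is a variable if edge $j$ is an outgoing edge of the source sending the $i$-th symbol, and $a_{i,j}=0$ otherwise. $B_t=(b_{t,i,j})$ is the $h\times|E|$ matrix in which $b_{t,i,j}$ is a variable if $\mathrm{head}(j)=t$ and $b_{t,i,j}=0$ otherwise. All these variables are distinct. The Edmonds matrix is $M_t=\begin{pmatrix}A&0\\ I-F&B_t^T\end{pmatrix}$; its determinant is a polynomial in these variables. The $u$-th path is the sequence of edges $l^{(u)}_1,\dots,l^{(u)}_{s_u}$, starting at the source of symbol $u$ and ending in $t$; the $h$ paths are edge disjoint if no edge occurs in two of them. *)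

(* Defs.v *)
From HB Require Import structures.
From mathcomp Require Import all_boot all_order all_algebra.
From mathcomp Require Import mpoly.

Set Implicit Arguments.
Unset Strict Implicit.
Unset Printing Implicit Defensive.

Import GRing.Theory.
Local Open Scope ring_scope.

(* Edges are numbered by ordinals and carry their end points as data, so
   parallel edges are allowed.  Acyclicity says that the only closed walk is
   the empty one; in particular there are no loops. *)
Record network := Network {
  vertex : finType;
  nedges : nat;
  etail : 'I_nedges -> vertex;
  ehead : 'I_nedges -> vertex;
  network_acyclic : forall c : seq 'I_nedges,
    cycle (fun i j => ehead i == etail j) c -> c = [::];
  sources : {set vertex};
  sinks : {set vertex};
  nsymb : nat;
  origin : 'I_nsymb -> vertex;
  origin_source : forall u, origin u \in sources
}.

(* Indices of the indeterminates a_{i,j}, f_{i,j} and b_{t,i,j}.  All index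
   tuples are included; those excluded by the topology of the network give
   indeterminates that occur in none of the matrices. *)
Definition coding_var (N : network) : finType :=
  ('I_(nsymb N) * 'I_(nedges N) + 'I_(nedges N) * 'I_(nedges N)
   + vertex N * 'I_(nsymb N) * 'I_(nedges N))%type.

Section Edmonds.
Variables (R : comNzRingType) (N : network).

Definition avar (i : 'I_(nsymb N)) (j : 'I_(nedges N)) :
    {mpoly R[#|coding_var N|]} :=
  'X_(enum_rank (inl (inl (i, j)) : coding_var N)).

Definition fvar (i j : 'I_(nedges N)) : {mpoly R[#|coding_var N|]} :=
  'X_(enum_rank (inl (inr (i, j)) : coding_var N)).

Definition bvar (t : vertex N) (i : 'I_(nsymb N)) (j : 'I_(nedges N)) :
    {mpoly R[#|coding_var N|]} :=
  'X_(enum_rank (inr (t, i, j) : coding_var N)).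

Definition Amx : 'M[{mpoly R[#|coding_var N|]}]_(nsymb N, nedges N) :=
  \matrix_(i, j) (if etail j == origin i then avar i j else 0).

Definition Fmx : 'M[{mpoly R[#|coding_var N|]}]_(nedges N) :=
  \matrix_(i, j) (if ehead i == etail j then fvar i j else 0).

Definition Bmx (t : vertex N) :
    'M[{mpoly R[#|coding_var N|]}]_(nsymb N, nedges N) :=
  \matrix_(i, j) (if ehead j == t then bvar t i j else 0).

(* The block matrix has h + |E| rows and |E| + h columns; the cast only makes
   its type square and leaves the order of the columns unchanged. *)
Definition Edmonds (t : vertex N) :
    'M[{mpoly R[#|coding_var N|]}]_(nsymb N + nedges N) :=
  castmx (erefl, addnC (nedges N) (nsymb N))
    (block_mx Amx 0 (1%:M - Fmx) (Bmx t)^T).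

End Edmonds.

(* A path with s edges is given by l 1, ..., l s; the values of l outside this
   range are irrelevant. *)
Definition is_path (N : network) (x y : vertex N) (s : nat)
    (l : nat -> 'I_(nedges N)) : Prop :=
  [/\ (1 <= s)%N, etail (l 1%N) = x,
      forall i, (1 <= i < s)%N -> ehead (l i) = etail (l i.+1)
    & ehead (l s) = y].

Definition edge_disjoint (N : network) (s : 'I_(nsymb N) -> nat)
    (l : 'I_(nsymb N) -> nat -> 'I_(nedges N)) : Prop :=
  forall u1 u2 i j, (1 <= i <= s u1)%N -> (1 <= j <= s u2)%N ->
    u1 <> u2 -> l u1 i <> l u2 j.

(* Main.v *)
(* A permutation contributing to the determinant matches rows with columns.
   Identifying the column of an edge (of a symbol) with the row of the same edge
   (symbol) turns it into an injective self-map p of symbols + edges.  Entries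
   are 0, 1 on the diagonal of I - F, or plus or minus one variable, so the
   contribution is a single monomial up to sign.  The orbit of a symbol returns
   to a symbol, and its edges up to the first return form one of the paths.
   Injectivity of p makes these paths disjoint; acyclicity forces every edge on
   no path to be fixed by p, that is, to contribute the entry 1. *)

Require Import Defs.
From HB Require Import structures.
From mathcomp Require Import all_boot all_order all_algebra.
From mathcomp Require Import perm.
From mathcomp Require Import mpoly.

Set Implicit Arguments.
Unset Strict Implicit.
Unset Printing Implicit Defensive.

Import GRing.Theory.
Local Open Scope ring_scope.

(** * Orbits of an injective self-map of a disjoint sum *)

(** An injective self-map of a finite type has cyclic orbits, so the orbit of a symbol meets a
    symbol again. The least positive return time exceeds 1 by [pfirst], and [s u] is one less than
    it. *)
Lemma first_return (H E : finType) (p : H + E -> H + E) (first : H -> E) :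
    injective p -> (forall u, p (inl u) = inr (first u)) ->
  exists (s : H -> nat) (l : H -> nat -> E) (v : H -> H),
    [/\ forall u, (1 <= s u)%N,
        forall u i, (1 <= i <= s u)%N -> iter i p (inl u) = inr (l u i)
      & forall u, p (inr (l u (s u))) = inl (v u)].
Proof.
move=> injp pfirst.
have returns u : exists n, (0 < n)%N && is_inl (iter n p (inl u)).
  by exists (order p (inl u)); rewrite order_gt0 iter_order.
pose r u := ex_minn (returns u).
(* The defaults [first u] and [u] only make the functions total; they are never taken at the indices
   that matter. *)
pose l u i := if iter i p (inl u) is inr e then e else first u.
pose v u := if iter (r u) p (inl u) is inl w then w else u.
have r_gt1 u : (1 < r u)%N.
  rewrite /r; case: ex_minnP => -[|[|n]] //.
  by rewrite /= pfirst.
have lP u i : (1 <= i <= (r u).-1)%N -> iter i p (inl u) = inr (l u i).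
  case/andP=> i_gt0 i_le; have: (i < r u)%N.
    by rewrite -(prednK (ltnW (r_gt1 u))).
  rewrite /l /r; case: ex_minnP => n _ minn i_lt.
  have: ~~ is_inl (iter i p (inl u)).
    apply/negP => iH; have := minn i; rewrite i_gt0 iH => /(_ isT).
    by rewrite leqNgt i_lt.
  by case: (iter i p (inl u)).
exists (fun u => (r u).-1), l, v; split=> // u.
  by rewrite -ltnS prednK // ltnW.
rewrite -lP; last by rewrite leqnn andbT -ltnS prednK // ltnW.
rewrite -iterS prednK ?(ltnW (r_gt1 u)) // /v.
rewrite /r; case: ex_minnP => n /andP[_].
by case: (iter n p (inl u)).
Qed.

(** Paths cannot merge because [p] can be cancelled: tracing a common edge back to the start of one
    path would put a symbol strictly inside the other. The last clause serves to show that an edge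
    on no path is fixed. *)
Lemma orbit_decomposition (H E : finType) (p : H + E -> H + E)
    (first : H -> E) :
    injective p -> (forall u, p (inl u) = inr (first u)) ->
  exists (s : H -> nat) (l : H -> nat -> E) (v : H -> H),
    [/\ forall u, (1 <= s u)%N,
        (forall u, p (inl u) = inr (l u 1%N))
        /\ (forall u i, (1 <= i < s u)%N -> p (inr (l u i)) = inr (l u i.+1)),
        forall u, p (inr (l u (s u))) = inl (v u),
        forall u1 u2 i j, (1 <= i <= s u1)%N -> (1 <= j <= s u2)%N ->
          l u1 i = l u2 j -> u1 = u2 /\ i = j
      & forall u n e, iter n p (inl u) = inr e ->
          exists u' i, (1 <= i <= s u')%N /\ e = l u' i].
Proof.
move=> injp pfirst; have [s [l [v [s_gt0 lP lv]]]] := first_return injp pfirst.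
have inj_le u1 u2 i j : (1 <= i <= s u1)%N -> (1 <= j <= s u2)%N -> (i <= j)%N ->
    l u1 i = l u2 j -> u1 = u2 /\ i = j.
  move=> hi hj le_ij eq_l.
  have: iter i p (inl u1) = iter i p (iter (j - i) p (inl u2)).
    by rewrite -iterD subnKC // !lP // eq_l.
  have inj_iter n : injective (iter n p) by elim: n => // n IHn x y /injp/IHn.
  move/inj_iter; case: (posnP (j - i)) => [ji0|ji_gt0].
    rewrite ji0 => -[->]; split=> //.
    by apply/eqP; rewrite eqn_leq le_ij -subn_eq0 ji0.
  rewrite (lP u2 (j - i)%N) // ji_gt0 (leq_trans (leq_subr _ _)) //.
  by case/andP: hj.
exists s, l, v; split=> //.
- split=> [u|u i /andP[i_gt0 i_lt]]; first by rewrite -lP ?s_gt0.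
  by rewrite -!lP ?iterS ?i_gt0 // ltnW.
- move=> u1 u2 i j hi hj eq_l; case/orP: (leq_total i j) => le.
    exact: inj_le eq_l.
  by have [-> ->] := inj_le _ _ _ _ hj hi le (esym eq_l).
move=> u n e ne.
have reach : exists m, [exists u', iter m p (inl u') == inr e].
  by exists n; apply/existsP; exists u; apply/eqP.
(* For the least such m, no symbol is met between [inl u'] and [inr e]. *)
case: (ex_minnP reach) => m /existsP[u' /eqP um] min_m.
have m_gt0 : (0 < m)%N by case: m um {min_m}.
exists u', m; case: (leqP m (s u')) => [m_le|m_gt].
  by split; rewrite ?m_gt0 //; move: um; rewrite lP ?m_gt0 // => -[].
(* Beyond [s u'] steps the orbit has passed through the symbol [v u'], from which [inr e] is reached
   in fewer steps, against minimality. *)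
have: (m <= m - (s u').+1)%N.
  apply: min_m; apply/existsP; exists (v u').
  by rewrite -lv -lP ?s_gt0 ?leqnn // -iterS -iterD subnK // um.
by rewrite leqNgt ltn_subrL m_gt0.
Qed.

(** * Entries of the Edmonds matrix and monomials of its determinant *)

(* Here x is a row and y a column of the Edmonds matrix, both taken in
   symbols + edges. *)
Definition row_col_monomial (N : network) (t : vertex N)
    (x y : 'I_(nsymb N) + 'I_(nedges N)) : 'X_{1..#|coding_var N|} :=
  match x, y with
  | inl u, inr j => U_(enum_rank (inl (inl (u, j)) : coding_var N))
  | inr i, inr j =>
      if i == j then 0 else U_(enum_rank (inl (inr (i, j)) : coding_var N))
  | inr i, inl w => U_(enum_rank (inr (t, w, i) : coding_var N))
  | inl _, inl _ => 0
  end%MM.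

Definition row_col_linked (N : network) (t : vertex N)
    (x y : 'I_(nsymb N) + 'I_(nedges N)) : bool :=
  match x, y with
  | inl u, inr j => etail j == origin u
  | inr i, inr j => (i == j) || (ehead i == etail j)
  | inr i, inl _ => ehead i == t
  | inl _, inl _ => false
  end.

(** Rows list symbols before edges, columns edges before symbols; hence the cast and the swap. *)
Definition col_index (N : network) (c : 'I_(nsymb N + nedges N)) :
    'I_(nsymb N) + 'I_(nedges N) :=
  match split (cast_ord (addnC (nsymb N) (nedges N)) c) with
  | inl j => inr j
  | inr w => inl w
  end.

Lemma col_index_inj (N : network) : injective (@col_index N).
Proof.
move=> c d; rewrite /col_index => eq_cd.
apply: (@cast_ord_inj _ _ (addnC (nsymb N) (nedges N))).
apply: (can_inj splitK); move: eq_cd.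
by case: (split _) => [?|?]; case: (split _) => [?|?] // [->].
Qed.

Lemma ehead_neq_etail (N : network) (e : 'I_(nedges N)) : ehead e != etail e.
Proof.
apply/negP => ee.
by have /= := @network_acyclic N [:: e]; rewrite ee => /(_ isT).
Qed.

(** Treating a zero entry as a zero multiple of a monomial gives all entries one shape, so that
    products of entries need no case analysis. *)
Lemma Edmonds_entry (R : comNzRingType) (N : network) (t : vertex N)
    (x : 'I_(nsymb N) + 'I_(nedges N)) (c : 'I_(nsymb N + nedges N)) :
  exists2 k : R,
    Edmonds R t (unsplit x) c = k *: 'X_[row_col_monomial t x (col_index c)]
    & k != 0 -> row_col_linked t x (col_index c).
Proof.
have ifX (b : bool) (m : 'X_{1..#|coding_var N|}) :
    exists2 k : R, (if b then 'X_[R, m] else 0) = k *: 'X_[m] & k != 0 -> b.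
  by exists b%:R; case: b; rewrite ?scale1r ?scale0r ?eqxx.
rewrite /Edmonds castmxE /= cast_ord_id /col_index.
have -> : cast_ord (esym (addnC (nedges N) (nsymb N))) c
          = cast_ord (addnC (nsymb N) (nedges N)) c by apply: val_inj.
rewrite -[cast_ord _ c]splitK.
case: x (split _) => [u|i] [j|w]; rewrite !unsplitK /=.
- by rewrite block_mxEul mxE; apply: ifX.
- by rewrite block_mxEur mxE; exists 0; rewrite ?scale0r ?eqxx.
- rewrite block_mxEdl !mxE; case: (altP (i =P j)) => [<-|ne_ij] /=.
    (* There are no loops, so [Fmx] vanishes on the diagonal and the entry is exactly 1. *)
    by exists 1; rewrite // (negPf (ehead_neq_etail i)) subr0 mpolyX0 scale1r.
  rewrite sub0r; have [k kE kP] := ifX (ehead i == etail j)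
    U_(enum_rank (inl (inr (i, j)) : coding_var N))%MM.
  by exists (- k); rewrite ?oppr_eq0 // scaleNr -kE.
- by rewrite block_mxEdr !mxE; apply: ifX.
Qed.

(** Some term of the Leibniz expansion has a nonzero coefficient at [K]. That term is a scalar times
    one monomial, so the monomial is [K] and none of the scalars [k x] vanishes. *)
Lemma msupp_det_Edmonds (R : comNzRingType) (N : network) (t : vertex N)
    (K : 'X_{1..#|coding_var N|}) :
    K \in msupp (\det (Edmonds R t)) ->
  exists p : 'I_(nsymb N) + 'I_(nedges N) -> 'I_(nsymb N) + 'I_(nedges N),
    [/\ injective p, forall x, row_col_linked t x (p x)
      & K = (\sum_(u < nsymb N) row_col_monomial t (inl u) (p (inl u))
          + \sum_(i < nedges N) row_col_monomial t (inr i) (p (inr i)))%MM].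
Proof.
rewrite mcoeff_msupp /determinant raddf_sum /= => nzK.
have [s nzs] : exists s : 'S_(nsymb N + nedges N),
    ((-1) ^+ s * \prod_i Edmonds R t i (s i))@_K != 0.
  apply/existsP; apply: contraNT nzK => /existsPn zK.
  by rewrite big1 // => s _; apply/eqP; rewrite -[_ == _]negbK zK.
pose p x := col_index (s (unsplit x)).
have /fin_all_exists[k kP] (x : 'I_(nsymb N) + 'I_(nedges N)) : exists k : R,
    Edmonds R t (unsplit x) (s (unsplit x))
    = k *: 'X_[row_col_monomial t x (p x)]
    /\ (k != 0 -> row_col_linked t x (p x)).
  by have [k] := Edmonds_entry R t x (s (unsplit x)); exists k.
exists p; split.
- by move=> x y /col_index_inj/perm_inj/(can_inj unsplitK).
- move=> x; apply: (kP x).2; apply: contraNneq nzs => kx0.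
  rewrite (bigD1 (unsplit x)) //= (kP x).1 kx0 scale0r mul0r mulr0.
  by rewrite mcoeff0.
apply/eqP; rewrite eq_sym; apply: contraNT nzs => neK.
rewrite big_split_ord /=.
under eq_bigr do rewrite (kP (inl _)).1.
under [X in _ * (_ * X)]eq_bigr do rewrite (kP (inr _)).1.
rewrite !scaler_prod !mprodXE -scalerAl -!scalerAr -mpolyXD !mcoeffZ.
rewrite mulr_sign; case: (odd_perm s);
  by rewrite ?mcoeffN mcoeffX (negPf neK) ?oppr0 !mulr0.
Qed.

(** * Acyclicity and the product of paths *)

(* An orbit of p without symbols, other than a fixed edge, would be a closed
   walk in the network. *)
Lemma unfixed_edge_reached (N : network) (t : vertex N)
    (p : 'I_(nsymb N) + 'I_(nedges N) -> 'I_(nsymb N) + 'I_(nedges N))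
    (e : 'I_(nedges N)) :
    injective p -> (forall x, row_col_linked t x (p x)) ->
    p (inr e) != inr e ->
  exists u n, iter n p (inl u) = inr e.
Proof.
move=> injp linkp unfixed_e.
case: (boolP (has is_inl (orbit p (inr e)))) => [/hasP[[u|//] /=]|noH].
  rewrite -fconnect_orbit (fconnect_sym injp) => ue _.
  by exists u, (findex p (inl u) (inr e)); apply: iter_findex.
pose c := [seq if x is inr i then i else e | x <- orbit p (inr e)].
have cE : map inr c = orbit p (inr e).
  rewrite -map_comp -[RHS]map_id; apply/eq_in_map => -[u|i] //= u_orb.
  by case/hasP: noH; exists (inl u).
(* Some iterate of [p] takes [inr e] to [inr i]; if [inr i] were fixed, cancelling that iterate
   would make [inr e] fixed. This rules out the diagonal case of [row_col_linked] along [c]. *)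
have unfixed i : i \in c -> p (inr i) != inr i.
  move=> ic; have : fconnect p (inr e) (inr i).
    by rewrite fconnect_orbit -cE map_f.
  move/iter_findex <-; rewrite -iterS iterSr; apply: contraNneq unfixed_e.
  by elim: (findex _ _ _) => [|n IHn] /= => [->|/injp].
have : cycle (fun i j : 'I_(nedges N) => ehead i == etail j) c.
  have := cycle_orbit injp (inr e); rewrite -cE cycle_map.
  apply: (@sub_in_cycle _ (mem c)); last exact/allP.
  move=> i j ic _ /= /eqP pij; have := linkp (inr i).
  rewrite pij /= => /orP[/eqP eq_ij|//].
  by have := unfixed i ic; rewrite pij eq_ij eqxx.
move/network_acyclic => c0; move: cE; rewrite c0 => /esym/(congr1 size).
by rewrite size_orbit => o0; have := order_gt0 p (inr e); rewrite o0.
Qed.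

Lemma fvar_inj (R : comNzRingType) (N : network) (i1 j1 i2 j2 : 'I_(nedges N)) :
  fvar R i1 j1 = fvar R i2 j2 -> i1 = i2 /\ j1 = j2.
Proof.
set m2 := U_(enum_rank (inl (inr (i2, j2)) : coding_var N))%MM.
move/(congr1 (mcoeff m2)); rewrite /fvar !mcoeffX eqxx.
case: eqP => [|_ /esym/eqP]; last by rewrite oner_eq0.
move/(congr1 (fun m : 'X_{1..#|coding_var N|} =>
  m (enum_rank (inl (inr (i1, j1)) : coding_var N)))).
rewrite !mnm1E eqxx; case: eqP => // /enum_rank_inj[-> ->] //.
Qed.

Theorem theorem11 (R : comNzRingType) (N : network) (t : vertex N)
    (ht : t \in sinks N) (K : 'X_{1..#|coding_var N|})
    (hK : K \in msupp (\det (Edmonds R t))) :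
  exists (s : 'I_(nsymb N) -> nat) (l : 'I_(nsymb N) -> nat -> 'I_(nedges N))
         (v : 'I_(nsymb N) -> 'I_(nsymb N)),
    (forall u, (1 <= s u)%N)
    /\ 'X_[R, K] = \prod_(u < nsymb N)
         (avar R u (l u 1%N)
          * (\prod_(1 <= i < s u) fvar R (l u i) (l u i.+1))
          * bvar R t (v u) (l u (s u)))
    /\ [set v u | u : 'I_(nsymb N)] = [set: 'I_(nsymb N)]
    /\ (forall u1 u2, u1 <> u2 -> l u1 1%N <> l u2 1%N)
    /\ (forall u1 u2, u1 <> u2 -> l u1 (s u1) <> l u2 (s u2))
    /\ (forall u1 u2 i j, (1 <= i < s u1)%N -> (1 <= j < s u2)%N ->
          ~ (u1 = u2 /\ i = j) ->
          fvar R (l u1 i) (l u1 i.+1) <> fvar R (l u2 j) (l u2 j.+1))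
    /\ (forall u, is_path (origin u) t (s u) (l u))
    /\ edge_disjoint s l.

Proof.
have [p [injp linkp KE]] := msupp_det_Edmonds hK.
have /fin_all_exists[first pfirst] u : exists j, p (inl u) = inr j.
  by have := linkp (inl u); case: (p (inl u)) => // j _; exists j.
have [s [l [v [s_gt0 [p1 pS] pv l_inj cover]]]] :=
  orbit_decomposition injp pfirst.
(* Inside a path [p] never uses a diagonal entry, so each step contributes a genuine variable. *)
have pS_neq u i : (1 <= i < s u)%N -> l u i != l u i.+1.
  move=> /[dup] hi /andP[i_gt0 i_lt]; apply/eqP => /l_inj[]//.
    by rewrite i_gt0 ltnW.
  by move=> _ /n_Sn.
have v_inj : injective v.
  move=> u1 u2 eq_v; have [] // : u1 = u2 /\ s u1 = s u2.
  apply: l_inj; rewrite ?s_gt0 ?leqnn //.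
  by apply: (@inr_inj 'I_(nsymb N)); apply: injp; rewrite !pv eq_v.
exists s, l, v; split=> //; split; [|split; [|split; [|split; [|split; [|split]]]]].
- rewrite KE mpolyXD -!mprodXE.
  (* The factors [avar] come from the symbol rows, all the others from the edge rows. *)
  under [RHS]eq_bigr do rewrite -mulrA.
  rewrite big_split /=; congr (_ * _).
    by apply: eq_bigr => u _; rewrite p1.
  pose G e : {mpoly R[#|coding_var N|]} :=
    'X_[row_col_monomial t (inr e) (p (inr e))].
  (* All edges of all paths, listed without repetition by [l_inj]. *)
  pose r := [seq l u i | u <- index_enum 'I_(nsymb N),
                         i <- index_iota 1 (s u).+1].
  have r_uniq : uniq r.
    apply: allpairs_uniq_dep => [|u _|]; rewrite ?index_enum_uniq ?iota_uniq //.
    move=> _ _ /allpairsPdep[u1 [i [_ hi ->]]] /allpairsPdep[u2 [j [_ hj ->]]] /=.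
    move: hi hj; rewrite !mem_index_iota => hi hj.
    by case/l_inj=> // -> ->.
  (* An edge outside [r] is fixed by [p], since otherwise a symbol's orbit would reach it; its
     factor is therefore 1. *)
  transitivity (\prod_(e <- r) G e).
    rewrite [RHS]big_uniq // [RHS]big_mkcond; apply: eq_bigr => e _.
    case: ifPn => // er; rewrite /row_col_monomial.
    have -> : p (inr e) = inr e; last by rewrite eqxx mpolyX0.
    apply/eqP; apply: contraNT er => /(unfixed_edge_reached injp linkp)[u [n]].
    case/cover=> u' [i [hi ->]]; apply/allpairsPdep; exists u', i.
    by rewrite mem_index_enum mem_index_iota.
  (* On each path the last edge yields the [bvar] factor and the earlier ones the [fvar] factors. *)
  rewrite big_allpairs_dep; apply: eq_bigr => u _.
  rewrite big_nat_recr //= /G pv; congr (_ * _).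
  by apply: eq_big_nat => i hi; rewrite pS //= (negPf (pS_neq _ _ hi)).
- apply/eqP; rewrite eqEcard subsetT /= card_imset //.
  by rewrite cardsT.
- by move=> u1 u2 ne_u /l_inj[]; rewrite ?s_gt0.
- by move=> u1 u2 ne_u /l_inj[]; rewrite ?s_gt0 ?leqnn.
- move=> u1 u2 i j /andP[i_gt0 i_lt] /andP[j_gt0 j_lt] ne /fvar_inj[/l_inj eq_l _].
  by apply/ne/eq_l; rewrite ?i_gt0 ?j_gt0 ltnW.
- move=> u; split=> //.
  + by apply/eqP; have := linkp (inl u); rewrite p1.
  + move=> i hi; apply/eqP; have := linkp (inr (l u i)).
    by rewrite pS //= (negPf (pS_neq _ _ hi)).
  + by apply/eqP; have := linkp (inr (l u (s u))); rewrite pv.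
- by move=> u1 u2 i j hi hj ne_u /l_inj[].
Qed.
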